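(* Let $\varepsilon\in\mathbb{R}$ satisfy $-\tfrac{1}{15}<\varepsilon<0$. Then the planar piecewise smooth system $$\dot x = 1-x-k(y)\,x,\qquad \dot y=\beta-\beta\varepsilon-k(y)\,\varepsilon-\alpha-(\beta+k(y))\,y-(\alpha\beta-\alpha)\,x,$$ with $\alpha=\tfrac45$, $\beta=\tfrac12$, $k(y)=1$ for $y>0$ and $k(y)=0$ for $y<0$, with dynamics on the splitting manifold $\{y=0\}$ given by Filippov's convention, has a unique unstable pseudonode.
   Context: For $\lambda\in[0,1]$ write $f(x,y;\lambda)=\bigl(1-x-\lambda x,\ \beta-\beta\varepsilon-\lambda\varepsilon-\alpha-(\beta+\lambda)y-(\alpha\beta-\alpha)x\bigr)$ with $\alpha=4/5$, $\beta=1/2$; equivalently $f(x,y;\lambda)=\bigl(1-(1+\lambda)x,\ -\tfrac{3}{10}+\tfrac25 x-(\tfrac12+\lambda)(y+\varepsilon)\bigr)$. The system is $(\dot x,\dot y)=f(x,y;k(y))$ for $y\neq 0$. The splitting manifold is $\{h=0\}$ with $h(x,y)=y$. Put $S=f\cdot\nabla h$, i.e. the second component of $f$. The sliding region is the set of points $(x,0)$ for which $S(x,0;\lambda)=0$ has a solution $\lambda=\lambda^*(x)\in[0,1]$ (for $\varepsilon\ne0$ this solution is unique). The sliding region is stable if $\frac{d}{d\lambda}S<0$ on it, and unstable if $\frac{d}{d\lambda}S>0$ on it. The sliding (Filippov) flow on the sliding region is the one-dimensional flow $\dot x=1-x-\lambda^*(x)\,x$. A pseudoequilibrium is an equilibrium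 of the sliding flow in the sliding region. A pseudoequilibrium is a pseudonode if it is a node for the sliding flow (here: the derivative of the right-hand side of the sliding flow at it is nonzero) and its stability under the sliding flow agrees with the stability of the sliding region. An unstable pseudonode is thus a pseudoequilibrium that is unstable for the sliding flow and lies in an unstable sliding region. *)

(* Defs.v *)
From Stdlib Require Import Reals ClassicalEpsilon.
From Coquelicot Require Import Coquelicot.
Open Scope R_scope.

(** * One-dimensional flows on a subset of the line *)

(** [phi] solves [x' = g x] on the time interval [[0,T]] while staying in [D];
    at the two end points of [[0,T]] the derivative is one-sided. *)
Definition is_solution (D : R -> Prop) (g : R -> R) (T : R) (phi : R -> R) : Prop :=
  forall t, 0 <= t <= T ->
    D (phi t) /\ D_in phi (fun s => g (phi s)) (fun s => 0 <= s <= T) t.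

(** Lyapunov stability. *)
Definition flow_stable (D : R -> Prop) (g : R -> R) (x0 : R) : Prop :=
  forall e, 0 < e -> exists d, 0 < d /\
    forall T phi, is_solution D g T phi -> Rabs (phi 0 - x0) < d ->
      forall t, 0 <= t <= T -> Rabs (phi t - x0) < e.

Definition flow_unstable (D : R -> Prop) (g : R -> R) (x0 : R) : Prop :=
  ~ flow_stable D g x0.

(** The derivative is taken within [D]; in the interior of [D] it is the
    ordinary derivative. *)
Definition is_node (D : R -> Prop) (g : R -> R) (x0 : R) : Prop :=
  exists d, D_in g (fun _ => d) D x0 /\ d <> 0.

(** * The piecewise smooth system *)

Definition alpha : R := 4 / 5.
Definition beta : R := 1 / 2.

(** The value at [0] is immaterial: see [filippov_k]. *)
Definition k (y : R) : R := if Rlt_dec 0 y then 1 else 0.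

(** The piecewise smooth system is [(x', y') = f eps x y (k y)] for [y <> 0]. *)
Definition f (eps x y lam : R) : R * R :=
  (1 - x - lam * x,
   beta - beta * eps - lam * eps - alpha - (beta + lam) * y
     - (alpha * beta - alpha) * x).

(** Filippov's convention: [k y] is the only admissible value of the switching
    parameter off the splitting manifold, and every value in [[0,1]] is
    admissible on it.  As [f] is affine in [lam], the vectors [f eps x 0 lam]
    with [lam] admissible are the convex combinations of the two one-sided
    limits of the vector field. *)
Definition filippov_k (y lam : R) : Prop :=
  0 <= lam <= 1 /\ (y <> 0 -> lam = k y).

(** The splitting manifold is [h = 0]; its points are [(x, 0)]. *)
Definition h (x y : R) : R := y.

(** [f . grad h]. *)
Definition S_h (eps x y lam : R) : R :=
  fst (f eps x y lam) * Derive (fun x' => h x' y) x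
  + snd (f eps x y lam) * Derive (fun y' => h x y') y.

Definition is_sliding_parameter (eps x lam : R) : Prop :=
  filippov_k 0 lam /\ S_h eps x 0 lam = 0.

(** The point [(x, 0)] lies in the sliding region. *)
Definition sliding_region (eps x : R) : Prop :=
  exists lam, is_sliding_parameter eps x lam.

(** The solution [lam] of [S_h eps x 0 lam = 0] in [[0,1]], which is unique when
    [eps <> 0]; the value is arbitrary outside the sliding region. *)
Definition lambda_star (eps x : R) : R :=
  epsilon (inhabits 0) (is_sliding_parameter eps x).

Definition sliding_region_stable (eps : R) : Prop :=
  forall x, sliding_region eps x ->
    Derive (fun lam => S_h eps x 0 lam) (lambda_star eps x) < 0.

Definition sliding_region_unstable (eps : R) : Prop :=
  forall x, sliding_region eps x ->
    0 < Derive (fun lam => S_h eps x 0 lam) (lambda_star eps x).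

(** Right-hand side of the sliding flow, that is [1 - x - lambda_star eps x * x]. *)
Definition sliding_field (eps x : R) : R :=
  fst (f eps x 0 (lambda_star eps x)).

Definition pseudoequilibrium (eps x : R) : Prop :=
  sliding_region eps x /\ sliding_field eps x = 0.

Definition sliding_flow_stable (eps x : R) : Prop :=
  flow_stable (sliding_region eps) (sliding_field eps) x.

Definition sliding_flow_unstable (eps x : R) : Prop :=
  flow_unstable (sliding_region eps) (sliding_field eps) x.

Definition pseudonode (eps x : R) : Prop :=
  pseudoequilibrium eps x
  /\ is_node (sliding_region eps) (sliding_field eps) x
  /\ ((sliding_flow_stable eps x /\ sliding_region_stable eps)
      \/ (sliding_flow_unstable eps x /\ sliding_region_unstable eps)).

Definition unstable_pseudonode (eps x : R) : Prop :=
  pseudonode eps x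
  /\ sliding_flow_unstable eps x /\ sliding_region_unstable eps.

(* Main.v *)
Require Import Defs.
From Stdlib Require Import Reals Lra ClassicalEpsilon.
From Coquelicot Require Import Coquelicot.
Open Scope R_scope.

(** The [y]-component of the vector field on [y = 0] is affine in [lam] with
    slope [- eps], so for [eps < 0] the sliding region is unstable, and it is
    the interval between [a = 3/4 + 15/4 eps] (where [lambda_star = 1]) and
    [b = 3/4 + 5/4 eps] (where [lambda_star = 0]).  Substituting [lambda_star]
    turns the sliding field into a quadratic polynomial with leading
    coefficient [- 2 / (5 eps) > 0].  It takes the value
    [1 - 2 a = - 1/2 - 15/2 eps] at [a], negative exactly because
    [- 1/15 < eps], and [1 - b > 0] at [b].  A convex quadratic that is negative
    at [a] and positive at [b] has one root [r] between them and the other root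
    [s] to the left of [a] ([sliding_field_factors]).  So [r] is the only
    pseudoequilibrium, and the slope there is positive.

    The slope makes [r] a node; its Lyapunov instability is shown
    with the explicit solutions of [u' = c u (u + p)], [u = x - r], which are
    available because the field is quadratic ([quadratic_source_unstable]). *)

(** * The upper root of a convex quadratic field *)

(** For [u = x - r] and [p = r - s] the equation is [u' = c u (u + p)], and
    [w = 1/u] satisfies the linear equation [w' = - c (1 + p w)].  Hence
    [w t = B exp (c p (T - t)) - 1/p]; taking [B = 1/e + 1/p] gives the orbit
    that reaches [u = e] at time [T].  Going back far enough in time, it starts
    as near to [r] as desired. *)
Lemma quadratic_source_unstable (D : R -> Prop) (g : R -> R) (c r s b : R) :
  0 < c -> s < r -> r < b ->
  (forall x, r <= x <= b -> D x /\ g x = c * (x - r) * (x - s)) ->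
  flow_unstable D g r.
Proof.
intros Hc Hsr Hrb HD Hst.
set (p := r - s). set (e := b - r).
assert (Hp : 0 < p) by (unfold p; lra).
assert (He : 0 < e) by (unfold e; lra).
destruct (Hst e He) as (d & Hd & H).
assert (Hip := Rinv_0_lt_compat _ Hp).
assert (Hie := Rinv_0_lt_compat _ He).
set (B := / e + / p).
assert (HB : 0 < B) by (unfold B; lra).
assert (Hcp : 0 < c * p) by now apply Rmult_lt_0_compat.
assert (HBcp : 0 < B * (c * p)) by now apply Rmult_lt_0_compat.
(* By [exp z >= 1 + z], [1 / u 0 >= 1 / e + B c p T], which exceeds [1 / d]
   for this [T]. *)
set (T := / d / (B * (c * p))).
assert (HT : 0 < T).
{ apply Rdiv_lt_0_compat; [now apply Rinv_0_lt_compat | exact HBcp]. }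
set (w := fun t => B * exp (c * p * (T - t)) - / p).
assert (Hw : forall t, t <= T -> / e + B * (c * p) * (T - t) <= w t).
{ intros t Ht. unfold w.
  assert (H1 := exp_ineq1_le (c * p * (T - t))).
  apply (Rmult_le_compat_l B) in H1; [unfold B in *; lra | lra]. }
assert (Hw' : forall t, t <= T -> / e <= w t).
{ intros t Ht. specialize (Hw t Ht).
  assert (0 <= B * (c * p) * (T - t)) by (apply Rmult_le_pos; lra). lra. }
set (phi := fun t => r + / w t).
assert (Hphi : forall t, t <= T -> r < phi t <= b).
{ intros t Ht. specialize (Hw' t Ht). unfold phi.
  assert (0 < / w t) by (apply Rinv_0_lt_compat; lra).
  assert (/ w t <= / / e) by (apply Rinv_le_contravar; lra).
  rewrite Rinv_inv in H1. unfold e in H1. lra. }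
assert (HphiT : phi T = b).
{ unfold phi, w. rewrite Rminus_diag, Rmult_0_r, exp_0, Rmult_1_r.
  replace (B - / p) with (/ e) by (unfold B; ring).
  rewrite Rinv_inv. unfold e. ring. }
assert (Hsol : is_solution D g T phi).
{ intros t [Ht0 HtT]. specialize (Hphi t HtT). split.
  - now apply HD; lra.
  - apply (D_in_imp _ _ no_cond); [now intros|].
    apply derivable_pt_lim_D_in, is_derive_Reals.
    destruct (HD (phi t)) as [_ ->]; [lra|].
    assert (Hwt : w t <> 0) by (specialize (Hw' t HtT); lra).
    assert (Hdw : is_derive w t (- (c * p) * (w t + / p))).
    { unfold w. auto_derive; [trivial | unfold Rminus; ring]. }
    unfold phi. auto_derive.
    + split; [eexists; exact Hdw | now split].
    + change (Derive (fun x => w x) t) with (Derive w t).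
      rewrite (is_derive_unique _ _ _ Hdw).
      replace (r + / w t - s) with (p + / w t) by (unfold p; ring).
      field; lra. }
assert (Hphi0 : Rabs (phi 0 - r) < d).
{ assert (Hb := Hphi 0 ltac:(lra)). rewrite Rabs_pos_eq by lra.
  unfold phi. replace (r + / w 0 - r) with (/ w 0) by ring.
  rewrite <- (Rinv_inv d). apply Rinv_lt_contravar.
  - apply Rmult_lt_0_compat; [now apply Rinv_0_lt_compat|].
    specialize (Hw' 0 ltac:(lra)). lra.
  - specialize (Hw 0 ltac:(lra)).
    replace (B * (c * p) * (T - 0)) with (/ d) in Hw by (unfold T; field; lra).
    lra. }
specialize (H T phi Hsol Hphi0 T ltac:(lra)).
rewrite HphiT, Rabs_pos_eq in H by lra. unfold e in H. lra.
Qed.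

(** A factored quadratic has slope [c (r - s)] at [r]; only its values on [D]
    enter the derivative within [D]. *)
Lemma quadratic_is_node (D : R -> Prop) (g : R -> R) (c r s : R) :
  c <> 0 -> s <> r -> D r ->
  (forall x, D x -> g x = c * (x - r) * (x - s)) -> is_node D g r.
Proof.
intros Hc Hsr Hr Hg. exists (c * (r - s)). split.
- apply limit1_ext with
    (fun x => (c * (x - r) * (x - s) - c * (r - r) * (r - s)) / (x - r)).
  + intros x [Hx _]. now rewrite (Hg x Hx), (Hg r Hr).
  + apply (D_in_imp (fun x => c * (x - r) * (x - s)) (fun _ => c * (r - s))
             no_cond); [now intros|].
    apply (derivable_pt_lim_D_in _ (fun _ => c * (r - s))), is_derive_Reals.
    auto_derive; [trivial | ring].
- apply Rmult_integral_contrapositive_currified; lra.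
Qed.

(** * The sliding region and the sliding flow *)

Lemma S_h_on_manifold (eps x lam : R) :
  S_h eps x 0 lam = - (3 / 10) + 2 / 5 * x - (1 / 2 + lam) * eps.
Proof.
unfold S_h, h. rewrite Derive_const, Derive_id.
unfold f; simpl. unfold alpha, beta. field.
Qed.

Lemma is_sliding_parameter_iff (eps x lam : R) : eps < 0 ->
  is_sliding_parameter eps x lam <->
  0 <= lam <= 1 /\ lam = (- (3 / 10) + 2 / 5 * x) / eps - 1 / 2.
Proof.
intros He. unfold is_sliding_parameter, filippov_k. rewrite S_h_on_manifold.
split.
- intros [[Hl _] HS]. split; [exact Hl|].
  replace (- (3 / 10) + 2 / 5 * x) with ((1 / 2 + lam) * eps) by lra.
  field; lra.
- intros [Hl Heq]. split; [split; [exact Hl | now intros []] |].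
  rewrite Heq. field; lra.
Qed.

Lemma sliding_region_iff (eps x : R) : eps < 0 ->
  sliding_region eps x <-> 3 / 4 + 15 / 4 * eps <= x <= 3 / 4 + 5 / 4 * eps.
Proof.
intros He. split.
- intros (lam & [[Hl _] HS]). rewrite S_h_on_manifold in HS.
  assert (0 <= lam * - eps) by (apply Rmult_le_pos; lra).
  assert (0 <= (1 - lam) * - eps) by (apply Rmult_le_pos; lra).
  lra.
- intros Hx. exists ((- (3 / 10) + 2 / 5 * x) / eps - 1 / 2).
  apply is_sliding_parameter_iff; [exact He|]. split; [|reflexivity].
  replace ((- (3 / 10) + 2 / 5 * x) / eps - 1 / 2)
    with ((3 / 10 - 2 / 5 * x + 1 / 2 * eps) / - eps) by (field; lra).
  split.
  + apply Rdiv_le_0_compat; lra.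
  + apply Rle_div_l; lra.
Qed.

Lemma sliding_field_eq (eps x : R) : eps < 0 -> sliding_region eps x ->
  sliding_field eps x
  = 1 - x - ((- (3 / 10) + 2 / 5 * x) / eps - 1 / 2) * x.
Proof.
intros He Hx.
assert (H := epsilon_spec (inhabits 0) _ Hx).
apply is_sliding_parameter_iff in H; [|exact He].
unfold sliding_field, lambda_star, f; simpl.
destruct H as [_ H]. now rewrite H at 1.
Qed.

Lemma sliding_region_unstable_of_neg (eps : R) :
  eps < 0 -> sliding_region_unstable eps.
Proof.
intros He x _.
rewrite (Derive_ext _ _ _ (S_h_on_manifold eps x)).
rewrite (is_derive_unique _ _ (- eps)); [lra|].
auto_derive; [trivial | ring].
Qed.

(** The roots of the quadratic sliding field have sum [(3 - 5 eps) / 4], which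
    gives [s] from the root [r] supplied by the intermediate value theorem.
    The sign of the field at the left end of the region puts [s] outside. *)
Lemma sliding_field_factors (eps : R) : - (1 / 15) < eps < 0 ->
  exists r s,
    s < 3 / 4 + 15 / 4 * eps < r /\ r < 3 / 4 + 5 / 4 * eps /\
    forall x, sliding_region eps x ->
      sliding_field eps x = - (2 / (5 * eps)) * (x - r) * (x - s).
Proof.
intros He.
(* [q] is the sliding field multiplied by [- 10 eps]. *)
set (q := fun x => 4 * x * x - (3 - 5 * eps) * x - 10 * eps).
set (a := 3 / 4 + 15 / 4 * eps). set (b := 3 / 4 + 5 / 4 * eps).
assert (Ha : q a < 0).
{ replace (q a) with (- eps * (- (5 + 75 * eps))) by (unfold q, a; field).
  assert (0 < - eps * (5 + 75 * eps)) by (apply Rmult_lt_0_compat; lra). lra. }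
assert (Hb : 0 < q b).
{ replace (q b) with (- eps * (5 / 2 - 25 / 2 * eps)) by (unfold q, b; field).
  apply Rmult_lt_0_compat; lra. }
assert (Hcont : continuity q) by (unfold q; reg).
destruct (IVT q a b Hcont) as (r & Hr & Hqr); [unfold a, b; lra | lra | lra |].
set (s := (3 - 5 * eps) / 4 - r).
assert (Hfac : forall x, q x = 4 * (x - r) * (x - s)).
{ intros x. rewrite <- (Rminus_0_r (q x)), <- Hqr. unfold q, s. field. }
assert (r <> a) by (intros ->; lra).
assert (r <> b) by (intros ->; lra).
exists r, s. split; [split|split].
- apply Rnot_le_lt. intros Hs. rewrite Hfac in Ha.
  assert (0 <= (r - a) * (s - a)) by (apply Rmult_le_pos; unfold a in *; lra).
  lra.
- lra.
- lra.
- intros x Hx. rewrite (sliding_field_eq eps x) by (exact Hx || lra).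
  replace (- (2 / (5 * eps)) * (x - r) * (x - s))
    with (- (q x / (10 * eps))) by (rewrite Hfac; field; lra).
  unfold q. field. lra.
Qed.

Theorem theorem1 (eps : R) (heps : - (1 / 15) < eps < 0) :
  exists! x : R, unstable_pseudonode eps x.
Proof.
destruct (sliding_field_factors eps heps) as (r & s & [Hs Har] & Hrb & Hfield).
assert (Hc : 0 < - (2 / (5 * eps))).
{ replace (- (2 / (5 * eps))) with (2 / (5 * - eps)) by (field; lra).
  apply Rdiv_lt_0_compat; lra. }
assert (Hneg : eps < 0) by lra.
assert (Hr : sliding_region eps r) by (apply sliding_region_iff; lra).
assert (Hregion := sliding_region_unstable_of_neg eps Hneg).
assert (Hflow : sliding_flow_unstable eps r).
{ apply (quadratic_source_unstable _ _ _ r s _ Hc ltac:(lra) Hrb).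
  intros x Hx.
  assert (Hx' : sliding_region eps x) by (apply sliding_region_iff; lra).
  split; [exact Hx' | now apply Hfield]. }
exists r. split.
- split; [|now split]. split; [split; [exact Hr|] | split].
  + rewrite (Hfield r Hr). ring.
  + apply (quadratic_is_node _ _ (- (2 / (5 * eps))) r s); lra || assumption.
  + right. now split.
- intros x [[[Hx Hx0] _] _]. rewrite (Hfield x Hx) in Hx0.
  apply sliding_region_iff in Hx; [|exact Hneg].
  apply Rmult_integral in Hx0. destruct Hx0 as [Hx0|Hx0]; [|lra].
  apply Rmult_integral in Hx0. destruct Hx0; lra.
Qed.
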